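(* (1) Suppose $\{g_1,\ldots,g_n\}\subset\mathscr{R}$. Then the ideal $\langle g_1,\ldots,g_n\rangle_{\mathscr{E}}$ has finite codimension if and only if $\langle g_1,\ldots,g_n\rangle_{\mathscr{R}}$ is a finite codimension ideal. Assuming that $\langle g_1,\ldots,g_n\rangle_{\mathscr{R}}$ has finite codimension, for nonnegative integers $i$ and $j$ one has $\mathcal{M}_{\mathscr{E}}^{i}\langle\lambda^j\rangle_{\mathscr{E}}\subseteq\langle g_1,\ldots,g_n\rangle_{\mathscr{E}}$ if and only if $\mathcal{M}_{\mathscr{R}}^{i}\langle\lambda^j\rangle_{\mathscr{R}}\subseteq\langle g_1,\ldots,g_n\rangle_{\mathscr{R}}$. (2) Let $g_1,\ldots,g_n\in K[x,\lambda]$ and $k\in\mathbb{N}$ be such that $\mathcal{M}_{K[x,\lambda]}^{k}\subseteq\langle g_1,\ldots,g_n\rangle_{K[x,\lambda]}\subseteq K[x,\lambda]$. Then, for nonnegative integers $i$ and $j$, $\mathcal{M}_{K[x,\lambda]}^{i}\langle\lambda^j\rangle_{K[x,\lambda]}\subseteq\langle g_1,\ldots,g_n\rangle_{K[x,\lambda]}$ if and only if $\mathcal{M}_{\mathscr{E}}^{i}\langle\lambda^j\rangle_{\mathscr{E}}\subseteq\langle g_1,\ldots,g_n\rangle_{\mathscr{E}}$. (3) For a finite codimension ideal $\langle g_1,\ldots,g_n\rangle_{\mathscr{R}}$ in $\mathscr{R}$ and an ideal $I$ in $\mathscr{E}$, $$I=\langle g_1,\ldots,g_n\rangle_{\mathscr{E}}\quad\text{if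 and only if}\quad I\cap\mathscr{R}=\langle g_1,\ldots,g_n\rangle_{\mathscr{R}}.$$ In particular, if $I,J$ are two ideals in $\mathscr{E}$, $I$ has finite codimension and $I\cap\mathscr{R}=J\cap\mathscr{R}$, then $I=J$. (4) For an ideal $I$ in $\mathscr{E}$ and $k\in\mathbb{N}$, the following three conditions are equivalent: (i) $\mathcal{M}_{\mathscr{E}}^{k}\subseteq I$; (ii) $\mathcal{M}_{\mathscr{R}}^{k}\subseteq I\cap\mathscr{R}$; (iii) $\mathcal{M}_{K[x,\lambda]}^{k}\subseteq I\cap K[x,\lambda]$.
   Context: Let $K=\mathbb{R}$. $\mathscr{E}$ is the ring of germs at the origin of smooth functions $\mathbb{R}\times\mathbb{R}\to\mathbb{R}$ in the variables $(x,\lambda)$. $K[x,\lambda]$ is the ring of polynomial germs, and $\mathscr{R}=\{f/g : f,g\in K[x,\lambda],\ g(0,0)\neq 0\}$ is the ring of fractional germs (the localization of $K[x,\lambda]$ at $\langle x,\lambda\rangle$); both are regarded as subrings of $\mathscr{E}$. For each of these rings $\mathcal{R}$, $\langle\cdots\rangle_{\mathcal{R}}$ is the ideal of $\mathcal{R}$ generated by the listed elements, and $\mathcal{M}_{\mathcal{R}}=\langle x,\lambda\rangle_{\mathcal{R}}$. An ideal $I$ of $\mathcal{R}\in\{\mathscr{E},\mathscr{R}\}$ has finite codimension when $\mathcal{M}_{\mathcal{R}}^{k}\subseteq I$ for some $k\in\mathbb{N}$. *)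

(* Defs.v *)
From HB Require Import structures.
From mathcomp Require Import all_boot all_order all_algebra.
From mathcomp Require Import all_classical all_reals all_analysis.

Set Implicit Arguments.
Unset Strict Implicit.
Unset Printing Implicit Defensive.
Import Order.TTheory GRing.Theory Num.Theory numFieldNormedType.Exports.

Local Open Scope classical_set_scope.
Local Open Scope ring_scope.
Local Open Scope quotient_scope.

(* The rings of germs considered here are all subrings of one ambient ring,
   so a ring is given by its underlying set S in the ambient ring A, and ideals
   of S are subsets of S. *)
Section Ideals.
Variable A : comNzRingType.
Implicit Types S I J G : set A.

Definition is_subring S : Prop :=
  [/\ S 1, forall a b, S a -> S b -> S (a - b)
    & forall a b, S a -> S b -> S (a * b)].

Definition is_ideal S I : Prop :=
  [/\ I `<=` S, I 0, forall a b, I a -> I b -> I (a + b)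
    & forall s a, S s -> I a -> I (s * a)].

Definition ideal_gen S G : set A := smallest (is_ideal S) G.

Definition ideal_mul S I J : set A :=
  ideal_gen S [set c | exists a b, [/\ I a, J b & c = a * b]].

(* The power with exponent 0 is the whole ring S. *)
Definition ideal_exp S I (k : nat) : set A := iter k (ideal_mul S I) S.

Lemma ideal_genP S G : is_subring S -> G `<=` S -> is_ideal S (ideal_gen S G).
Proof.
move=> [S1 SB SM] GS.
have S0 : S 0 by rewrite -(subrr 1); exact: SB.
have SD a b : S a -> S b -> S (a + b).
  by move=> Sa Sb; rewrite -[b]opprK; apply: (SB) => //; rewrite -sub0r; exact: SB.
split.
- by apply: smallest_sub => //; split.
- by move=> I [[]].
- by move=> a b Ia Ib I IP; case: (IP) => -[_ _ ID _] _; apply: ID; [exact: Ia|exact: Ib].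
- by move=> s a Ss Ia I IP; case: (IP) => -[_ _ _ IM] _; apply: IM => //; exact: Ia.
Qed.

End Ideals.

Section Germs.
Variable R : realType.

Definition vanishes_near0 : {pred (R * R -> R)} :=
  fun f => `[< \forall p \near ((0, 0) : R * R), f p = 0 >].

Lemma vanishes_near0_idealr : idealr_closed vanishes_near0.
Proof.
split.
- by apply/asboolP; near=> p.
- apply/asboolP => /nbhs_singleton /eqP.
  by apply/negP; exact: oner_neq0.
- move=> a f g /asboolP f0 /asboolP g0; apply/asboolP.
  near=> p.
  have fp : f p = 0 by near: p.
  have gp : g p = 0 by near: p.
  by rewrite /GRing.add /GRing.mul /= fp gp mulr0 addr0.
Unshelve. all: by end_near.
Qed.

HB.instance Definition _ :=
  isIdealr.Build (R * R -> R)%type vanishes_near0 vanishes_near0_idealr.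

(* Germs at the origin of arbitrary functions of (x, lambda). *)
Definition germ_ring : comNzRingType := {ideal_quot vanishes_near0}.

Definition germ (f : R * R -> R) : germ_ring := \pi_({ideal_quot vanishes_near0}) f.

Lemma germP f g :
  germ f = germ g <-> \forall p \near ((0, 0) : R * R), f p = g p.
Proof.
have E : (germ f == germ g) = (f - g \in vanishes_near0).
  by rewrite -Quotient.idealrBE.
split.
- move=> /eqP; rewrite E => /asboolP; apply: filterS => p /eqP.
  by rewrite subr_eq0 => /eqP.
- move=> fg; apply/eqP; rewrite E; apply/asboolP; apply: filterS fg => p fgp.
  by rewrite /GRing.add /GRing.opp /= fgp subrr.
Qed.

Lemma germ1 : germ 1 = 1. Proof. exact: rmorph1. Qed.

Lemma germB f g : germ (f - g) = germ f - germ g. Proof. exact: rmorphB. Qed.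

Lemma germM f g : germ (f * g) = germ f * germ g. Proof. exact: rmorphM. Qed.

Definition e_x : R * R := (1, 0).
Definition e_lambda : R * R := (0, 1).

(* f has on U all partial derivatives of order at most k, and they are
   continuous on U. *)
Fixpoint Ck (k : nat) (U : set (R * R)) (f : R * R -> R) : Prop :=
  (forall p, U p -> {for p, continuous f}) /\
  if k is k'.+1 then
    [/\ forall p, U p -> derivable f p e_x /\ derivable f p e_lambda,
        Ck k' U ('D_e_x f) & Ck k' U ('D_e_lambda f)]
  else True.

Definition smooth_on U f : Prop := forall k, Ck k U f.

Definition smooth_near0 f : Prop :=
  exists U : set (R * R), [/\ open U, U (0, 0) & smooth_on U f].

Definition smooth_germs : set germ_ring := [set germ f | f in smooth_near0].

(* x is the outer indeterminate of p and lambda the inner one. *)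
Definition poly_fun (p : {poly {poly R}}) : R * R -> R :=
  fun z => p.[z.1, z.2].

Definition poly_germs : set germ_ring := range (fun p => germ (poly_fun p)).

(* Only the values of p / q near the origin, where q does not vanish, matter. *)
Definition frac_germs : set germ_ring :=
  [set h | exists p q : {poly {poly R}}, poly_fun q (0, 0) != 0 /\
    h = germ (fun z => poly_fun p z / poly_fun q z)].

Definition x_germ : germ_ring := germ (fun z => z.1).
Definition lambda_germ : germ_ring := germ (fun z => z.2).

Definition max_ideal (S : set germ_ring) : set germ_ring :=
  ideal_gen S [set x_germ; lambda_germ].

Definition finite_codim (S I : set germ_ring) : Prop :=
  exists k : nat, ideal_exp S (max_ideal S) k `<=` I.

Lemma Ck_subset k (U V : set (R * R)) f : U `<=` V -> Ck k V f -> Ck k U f.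
Proof.
move=> UV; elim: k f => [|k IH] f [cf H]; split.
- by move=> p /UV; exact: cf.
- by [].
- by move=> p /UV; exact: cf.
- case: H => df fx fl; split; [|exact: IH|exact: IH].
  by move=> p /UV; exact: df.
Qed.

Section Closure.
Variable U : set (R * R).
Hypothesis openU : open U.
Implicit Types f g : R * R -> R.

Lemma Ck_continuous k f : Ck k U f -> forall p, U p -> {for p, continuous f}.
Proof. by case: k => [|k] []. Qed.

Lemma CkW k f : Ck k.+1 U f -> Ck k U f.
Proof.
elim: k f => [|k IH] f [cf H]; first by split.
by case: H => df dfx dfl; split; [|split; [|apply: IH dfx|apply: IH dfl]].
Qed.

Lemma Ck_ext k f g : (forall p, U p -> f p = g p) -> Ck k U f -> Ck k U g.
Proof.
have near_fg (f1 g1 : R * R -> R) p : (forall p, U p -> f1 p = g1 p) -> U p ->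
    \forall q \near p, f1 q = g1 q.
  move=> fg Up; have := open_nbhs_nbhs (conj openU Up).
  by apply: filterS => q; exact: fg.
elim: k f g => [|k IH] f g fg [cf H]; split=> //.
- move=> p Up; rewrite /prop_for /continuous_at -fg//.
  by apply: cvg_trans (cf p Up); apply: near_eq_cvg; exact: near_fg.
- move=> p Up; rewrite /prop_for /continuous_at -fg//.
  by apply: cvg_trans (cf p Up); apply: near_eq_cvg; exact: near_fg.
case: H => df dfx dfl; split.
- move=> p Up; have [d1 d2] := df p Up.
  by split; [apply: near_eq_derivable d1|apply: near_eq_derivable d2];
    exact: near_fg.
- by apply: IH dfx => p Up; apply: near_eq_derive; exact: near_fg.
- by apply: IH dfl => p Up; apply: near_eq_derive; exact: near_fg.
Qed.

Lemma Ck_cst k (c : R) : Ck k U (cst c).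
Proof.
elim: k c => [|k IH] c; (split; first by move=> p _; exact: cst_continuous) => //.
split.
- by move=> p _; split; exact: derivable_cst.
- by apply: Ck_ext (IH 0) => p _; rewrite derive_cst.
- by apply: Ck_ext (IH 0) => p _; rewrite derive_cst.
Qed.

Lemma Ck_add k f g : Ck k U f -> Ck k U g -> Ck k U (f + g).
Proof.
elim: k f g => [|k IH] f g [cf Hf] [cg Hg]; (split; first by move=> p Up; apply: continuousD; [exact: cf|exact: cg]) => //.
case: Hf => df fx fl; case: Hg => dg gx gl; split.
- move=> p Up; have [f1 f2] := df p Up; have [g1 g2] := dg p Up.
  by split; [exact: (derivableD f1 g1)|exact: (derivableD f2 g2)].
- apply: Ck_ext (IH _ _ fx gx) => p Up.
  by have [f1 f2] := df p Up; have [g1 g2] := dg p Up; rewrite (deriveD f1 g1).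
- apply: Ck_ext (IH _ _ fl gl) => p Up.
  by have [f1 f2] := df p Up; have [g1 g2] := dg p Up; rewrite (deriveD f2 g2).
Qed.

Lemma Ck_mul k f g : Ck k U f -> Ck k U g -> Ck k U (f * g).
Proof.
elim: k f g => [|k IH] f g Hf0 Hg0; have [cf Hf] := Hf0; have [cg Hg] := Hg0;
  (split; first by move=> p Up; apply: continuousM; [exact: cf|exact: cg]) => //.
case: Hf => df fx fl; case: Hg => dg gx gl; split.
- move=> p Up; have [f1 f2] := df p Up; have [g1 g2] := dg p Up.
  by split; [exact: (derivableM f1 g1)|exact: (derivableM f2 g2)].
- apply: Ck_ext (Ck_add (IH _ _ (CkW Hf0) gx) (IH _ _ (CkW Hg0) fx)) => p Up.
  by have [f1 f2] := df p Up; have [g1 g2] := dg p Up; rewrite (deriveM f1 g1).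
- apply: Ck_ext (Ck_add (IH _ _ (CkW Hf0) gl) (IH _ _ (CkW Hg0) fl)) => p Up.
  by have [f1 f2] := df p Up; have [g1 g2] := dg p Up; rewrite (deriveM f2 g2).
Qed.

Lemma Ck_inv k f : (forall p, U p -> f p != 0) -> Ck k U f ->
  Ck k U (fun p => (f p)^-1).
Proof.
move=> f0; elim: k => [|k IH] Hf0; have [cf Hf] := Hf0; 
  (split; first by move=> p Up; apply: continuousV; [exact: f0|exact: cf]) => //.
case: Hf => df fx fl; have Hi := IH (CkW Hf0).
have Hii := Ck_mul (Ck_cst k (-1)) (Ck_mul Hi Hi).
split.
- by move=> p Up; have [f1 f2] := df p Up; split; [exact: (derivableV (f0 p Up) f1)|exact: (derivableV (f0 p Up) f2)].
- apply: Ck_ext (Ck_mul Hii fx) => p Up; have [f1 f2] := df p Up.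
  rewrite (deriveV (f0 p Up) f1).
  rewrite -[RHS]/(- (f p ^+ 2)^-1 * _) -[LHS]/(-1 * ((f p)^-1 * (f p)^-1) * _).
  by rewrite mulN1r expr2 invfM.
- apply: Ck_ext (Ck_mul Hii fl) => p Up; have [f1 f2] := df p Up.
  rewrite (deriveV (f0 p Up) f2).
  rewrite -[RHS]/(- (f p ^+ 2)^-1 * _) -[LHS]/(-1 * ((f p)^-1 * (f p)^-1) * _).
  by rewrite mulN1r expr2 invfM.
Qed.

Lemma Ck_coord k (f : R * R -> R) (cf : continuous f)
  (f_lin : forall (h : R) v p, f (h *: v + p) = h * f v + f p) : Ck k U f.
Proof.
have Df p v : derivable f p v /\ 'D_v f p = f v.
  suff H : (fun h => h^-1 *: ((f \o shift p) (h *: v) - f p)) @ 0^' --> f v.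
    by split; [apply/cvg_ex; exists (f v)|exact: (cvg_lim _ H)].
  apply: (@cvg_trans _ (cst (f v) @ (0 : R)^')); last exact: cvg_cst.
  apply: near_eq_cvg; near=> h.
  have h0 : h != 0 by near: h; exact: nbhs_dnbhs_neq.
  by rewrite /= f_lin addrK /GRing.scale /= mulKf.
case: k => [|k]; split=> //; try by move=> p _; exact: cf.
split.
- by move=> p _; split; [exact: (Df p e_x).1|exact: (Df p e_lambda).1].
- by apply: Ck_ext (Ck_cst k (f e_x)) => p _; rewrite (Df p e_x).2.
- by apply: Ck_ext (Ck_cst k (f e_lambda)) => p _; rewrite (Df p e_lambda).2.
Unshelve. all: by end_near.
Qed.

Lemma Ck_fst k : Ck k U (fun z => z.1).
Proof. by apply: Ck_coord => //; move=> z; exact: cvg_fst. Qed.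

Lemma Ck_snd k : Ck k U (fun z => z.2).
Proof. by apply: Ck_coord => //; move=> z; exact: cvg_snd. Qed.

Lemma Ck_poly k p : Ck k U (poly_fun p).
Proof.
elim/poly_ind: p => [|p c IH].
  by apply: Ck_ext (Ck_cst k 0) => z _; rewrite /poly_fun !horner0.
have Hc : Ck k U (fun z : R * R => c.[z.2]).
  elim/poly_ind: c {p IH} => [|c a IH].
    by apply: Ck_ext (Ck_cst k 0) => z _; rewrite horner0.
  apply: Ck_ext (Ck_add (Ck_mul IH (Ck_snd k)) (Ck_cst k a)) => z _.
  by rewrite hornerMXaddC.
apply: Ck_ext (Ck_add (Ck_mul IH (Ck_fst k)) Hc) => z _.
by rewrite /poly_fun hornerMXaddC hornerD hornerM hornerC.
Qed.

End Closure.

Lemma smooth_near0_cst (c : R) : smooth_near0 (cst c).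
Proof. by exists setT; split=> //; [exact: openT|move=> k; exact: (Ck_cst openT)]. Qed.

Lemma smooth_near0D f g :
  smooth_near0 f -> smooth_near0 g -> smooth_near0 (f + g).
Proof.
move=> [U [oU U0 Uf]] [V [oV V0 Vg]]; exists (U `&` V).
have oUV := openI oU oV; split=> // k.
by apply: Ck_add => //; [apply: (Ck_subset _ (Uf k)) => p []|
  apply: (Ck_subset _ (Vg k)) => p []].
Qed.

Lemma smooth_near0M f g :
  smooth_near0 f -> smooth_near0 g -> smooth_near0 (f * g).
Proof.
move=> [U [oU U0 Uf]] [V [oV V0 Vg]]; exists (U `&` V).
have oUV := openI oU oV; split=> // k.
by apply: Ck_mul => //; [apply: (Ck_subset _ (Uf k)) => p []|
  apply: (Ck_subset _ (Vg k)) => p []].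
Qed.

Lemma open_poly_fun_neq0 q : open [set z | poly_fun q z != 0].
Proof.
apply: (@open_comp _ _ (poly_fun q) [set x : R | x != 0]); last exact: open_neq.
by move=> z _; exact: (Ck_continuous (Ck_poly openT 0 q)).
Qed.

Lemma smooth_near0_frac p q : poly_fun q (0, 0) != 0 ->
  smooth_near0 (fun z => poly_fun p z / poly_fun q z).
Proof.
move=> q0; exists [set z | poly_fun q z != 0].
have oU := @open_poly_fun_neq0 q; split=> // k; apply: (Ck_mul oU (Ck_poly oU k p)).
by apply: (Ck_inv oU) => //; exact: (Ck_poly oU).
Qed.

Lemma poly_fun0 (c : R) : poly_fun c%:P%:P = cst c.
Proof. by apply/funext => z; rewrite /poly_fun !hornerC. Qed.

Lemma poly_funB p q : poly_fun (p - q) = poly_fun p - poly_fun q.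
Proof. by apply/funext => z; rewrite /poly_fun !hornerD !hornerN. Qed.

Lemma poly_funM p q : poly_fun (p * q) = poly_fun p * poly_fun q.
Proof. by apply/funext => z; rewrite /poly_fun !hornerM. Qed.

Lemma poly_germs_subring : is_subring poly_germs.
Proof.
split.
- by exists 1 => //; rewrite -germ1; congr germ; exact: (poly_fun0 1).
- by move=> _ _ [p _ <-] [q _ <-]; exists (p - q) => //; rewrite poly_funB germB.
- by move=> _ _ [p _ <-] [q _ <-]; exists (p * q) => //; rewrite poly_funM germM.
Qed.

Lemma poly_germs_frac : poly_germs `<=` frac_germs.
Proof.
move=> _ [p _ <-]; exists p, 1; have -> : poly_fun 1 = cst 1 by exact: (poly_fun0 1).
split; first exact: oner_neq0.
by congr germ; apply/funext => z; rewrite divr1.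
Qed.

Lemma frac_germs_smooth : frac_germs `<=` smooth_germs.
Proof.
move=> _ [p [q [q0 ->]]]; exists (fun z => poly_fun p z / poly_fun q z) => //.
exact: smooth_near0_frac.
Qed.

Lemma frac_germs_subring : is_subring frac_germs.
Proof.
have near_neq0 q : poly_fun q (0, 0) != 0 ->
    \forall z \near ((0, 0) : R * R), poly_fun q z != 0.
  by move=> q0; apply: open_nbhs_nbhs; split=> //; exact: open_poly_fun_neq0.
split.
- by apply: poly_germs_frac; have [] := poly_germs_subring.
- move=> _ _ [p [q [q0 ->]]] [r [s [s0 ->]]].
  exists (p * s - r * q), (q * s); rewrite poly_funB !poly_funM.
  split; first exact: mulf_neq0.
  rewrite -germB; apply/germP.
  apply: filterS2 (near_neq0 q q0) (near_neq0 s s0) => z qz sz.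
  rewrite -[LHS]/(poly_fun p z / poly_fun q z - poly_fun r z / poly_fun s z).
  rewrite -[RHS]/((poly_fun p z * poly_fun s z - poly_fun r z * poly_fun q z)
    / (poly_fun q z * poly_fun s z)).
  by rewrite -mulNr addf_div// mulNr.
- move=> _ _ [p [q [q0 ->]]] [r [s [s0 ->]]].
  exists (p * r), (q * s); rewrite !poly_funM.
  split; first exact: mulf_neq0.
  by rewrite -germM; congr germ; apply/funext => z; rewrite -mulf_div.
Qed.

Lemma smooth_germs_subring : is_subring smooth_germs.
Proof.
split.
- by exists 1; [exact: (smooth_near0_cst 1)|exact: germ1].
- move=> _ _ [f sf <-] [g sg <-]; exists (f - g); last exact: germB.
  rewrite -mulN1r; apply: smooth_near0D => //; apply: smooth_near0M => //.
  exact: (smooth_near0_cst (-1)).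
- move=> _ _ [f sf <-] [g sg <-]; exists (f * g); last exact: germM.
  exact: smooth_near0M.
Qed.

Lemma x_germ_poly : poly_germs x_germ.
Proof.
exists 'X => //; congr germ; apply/funext => z.
by rewrite /poly_fun hornerX hornerC.
Qed.

Lemma lambda_germ_poly : poly_germs lambda_germ.
Proof.
exists 'Y => //; congr germ; apply/funext => z.
by rewrite /poly_fun hornerC hornerX.
Qed.

End Germs.

Arguments smooth_germs : clear implicits.
Arguments frac_germs : clear implicits.
Arguments poly_germs : clear implicits.
Arguments x_germ : clear implicits.
Arguments lambda_germ : clear implicits.

(* Main.v *)
(* Each of the three rings S consists of germs h = h(0) + x a + lambda b with a, b
   again in S; for smooth germs this is Hadamard's lemma, obtained by
   differentiating under the integral sign. Iterating, every smooth germ is a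
   polynomial modulo M_E^k, and an element of S lying in M_E^k lies in M_S^k, since
   a nonzero homogeneous polynomial of degree d is not in M_E^(d+1). Hence, if
   M_S^k is contained in <g>_S, then the coefficients of a combination h in S of
   the g_l over E may be replaced by polynomials, up to an error in M_S^k, so h is
   in <g>_S. All the inclusions to be compared only have to be tested on monomials.
   The remaining point, that finite codimension descends from E to the fractional
   germs, is Nakayama's lemma in that local ring. *)
Require Import Defs.
From HB Require Import structures.
From mathcomp Require Import all_boot all_order all_algebra.
From mathcomp Require Import all_classical all_reals all_analysis.
From mathcomp Require Import ring.

Set Implicit Arguments.
Unset Strict Implicit.
Unset Printing Implicit Defensive.
Import Order.TTheory GRing.Theory Num.Theory numFieldNormedType.Exports.

Local Open Scope classical_set_scope.
Local Open Scope ring_scope.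
Local Open Scope quotient_scope.

(** * Hadamard's lemma *)

Lemma continuous_pair (T U V : topologicalType) (f : T -> U) (g : T -> V) x :
  {for x, continuous f} -> {for x, continuous g} ->
  {for x, continuous (fun y => (f y, g y))}.
Proof. by move=> cf cg; exact: (@cvg_pair _ _ _ (nbhs x) (nbhs (f x)) (nbhs (g x))). Qed.

(** * Continuity of integrals over the unit interval in a parameter *)

Section UnitIntegral.
Variable R : realType.
Notation mu := (@lebesgue_measure R).

Definition int01 (f : R -> R) : R := \int[mu]_(t in `[0, 1]) f t.

Section Continuity.
Variables (T : topologicalType) (phi : T -> R -> R).
Notation joint := (fun q : T * R => phi q.1 q.2).

Lemma continuous_sectionr z t : {for (z, t), continuous joint} ->
  {for t, continuous (phi z)}.
Proof.
move=> c; rewrite -[phi z]/(joint \o (fun s : R => (z, s))).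
apply: (continuous_comp (f := fun s : R => (z, s)) _ c).
by apply: continuous_pair; [exact: cvg_cst|exact: cvg_id].
Qed.

Lemma integrable_section z :
  (forall t : R, t \in `[0, 1] -> {for (z, t), continuous joint}) ->
  mu.-integrable `[0, 1] (EFin \o phi z).
Proof.
move=> c; apply: continuous_compact_integrable; first exact: segment_compact.
apply: continuous_in_subspaceT => t; rewrite inE /= => t01.
exact/continuous_sectionr/c.
Qed.

(** Tube argument: continuity at each [(z, t)] controls a product neighbourhood, and compactness of
    [0, 1] leaves one neighbourhood of [z] that serves every [t]. *)
Lemma near_section z (e : R) : 0 < e ->
  (forall t : R, t \in `[0, 1] -> {for (z, t), continuous joint}) ->
  \forall w \near z, forall t : R, t \in `[0, 1] -> `|phi z t - phi w t| < e.
Proof.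
move=> e0 c.
have /compact_near_coveringP nc := @segment_compact R 0 1.
suff H (t : R) : [set` `[0, 1]] t ->
    \forall s \near t & w \near z, `|phi z s - phi w s| < e.
  have := nc T (nbhs z) (fun w t => `|phi z t - phi w t| < e) (nbhs_filter z) H.
  by apply: filterS => w h s; exact: (h s).
move=> /= t01.
(* Both [phi z s] and [phi w s] are compared with [phi z t], each within e/2. *)
have e20 : 0 < e / 2 by rewrite divr_gt0.
have /cvgrPdist_lt/(_ _ e20) c1 := c t t01.
have /cvgrPdist_lt/(_ _ e20) /= c2 := continuous_sectionr (c t t01).
have c1' : \forall p \near nbhs (t, z), `|phi z t - phi p.2 p.1| < e / 2.
  case: c1 => -[A B] /= [nA nB] AB; exists (B, A) => //= -[s w] /= [Bs Aw].
  exact: (AB (w, s)).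
have c2' : \forall p \near nbhs (t, z), `|phi z t - phi z p.1| < e / 2.
  exists ([set s | `|phi z t - phi z s| < e / 2], setT) => /=.
    by split=> //; exact: filterT.
  by move=> -[s w] /= [].
apply: filterS2 c1' c2' => -[s w] /= h1 h2.
rewrite (splitr e) (le_lt_trans (ler_distD (phi z t) _ _))// ltrD//.
by rewrite distrC.
Qed.

Lemma continuous_int01 z :
  (\forall w \near z, forall t : R, t \in `[0, 1] -> {for (w, t), continuous joint}) ->
  {for z, continuous (fun w => int01 (phi w))}.
Proof.
move=> nc; apply/cvgrPdist_lt => e e0.
have cz := nbhs_singleton nc.
(* Integration only gives a weak inequality; the bound e/2 over an interval of length 1 restores the
   strict one. *)
have e20 : 0 < e / 2 by rewrite divr_gt0.
apply: filterS2 nc (near_section e20 cz) => w cw wz.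
have [iz iw] := (integrable_section cz, integrable_section cw).
rewrite /int01 -RintegralB//.
have iB : mu.-integrable `[0, 1] (EFin \o (fun t => phi z t - phi w t)).
  exact: (integrableB _ iz iw).
apply: (le_lt_trans (le_normr_Rintegral _ iB)) => //.
apply: (@le_lt_trans _ _ (\int[mu]_(t in `[0, 1]) (e / 2))).
  apply: le_Rintegral => //.
  - exact: integrable_norm iB.
  - apply: continuous_compact_integrable; first exact: segment_compact.
    by apply: continuous_subspaceT; exact: cst_continuous.
  - by move=> t /= /wz /ltW.
have mu01 : fine (mu `[0, 1]) = 1.
  by rewrite lebesgue_measure_itv/= lte_fin ltr01 -EFinB/= subr0.
rewrite Rintegral_cst// [X in _ * X]mu01 mulr1.
by rewrite ltr_pdivrMr// ltr_pMr// ltr1n.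
Qed.

End Continuity.

End UnitIntegral.

(** * Directional derivatives of parameter integrals *)

Section DerivativeUnderIntegral.
Variables (R : realType) (V : normedModType R).
Notation mu := (@lebesgue_measure R).

(** The two difference quotients are the same function of the increment. *)
Lemma is_derive_lineP (f : V -> R) (a v : V) (s d : R) :
  is_derive s 1 (fun h : R => f (h *: v + a)) d <->
  is_derive (s *: v + a) v f d.
Proof.
have E : (fun h : R => h^-1 *: (((fun h : R => f (h *: v + a)) \o shift s)
      (h *: (1 : R)) - f (s *: v + a))) =
    (fun h => h^-1 *: ((f \o shift (s *: v + a)) (h *: v) - f (s *: v + a))).
  by apply/funext => h /=; rewrite [h *: 1]mulr1 scalerDl addrA.
by split => -[h1 h2]; split; move: h1 h2; rewrite /derivable /derive E.
Qed.

(** Restriction to the line [h *: v + z] leaves one real parameter, to which dominated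
    differentiation under the integral sign applies near h = 0. *)
Lemma is_derive_int01 (phi psi : V -> R -> R) (U : set V) (v z : V) :
  open U -> U z ->
  (forall w (t : R), U w -> t \in `[0, 1] ->
    {for (w, t), continuous (fun q : V * R => phi q.1 q.2)}) ->
  (forall w (t : R), U w -> t \in `[0, 1] ->
    {for (w, t), continuous (fun q : V * R => psi q.1 q.2)}) ->
  (forall w (t : R), U w -> t \in `[0, 1] -> is_derive w v (phi^~ t) (psi w t)) ->
  is_derive z v (fun w => int01 (phi w)) (int01 (psi z)).
Proof.
move=> oU Uz cphi cpsi dphi.
pose l (h : R) : V := h *: v + z.
have l0 : l 0 = z by rewrite /l scale0r add0r.
have cl : {for 0, continuous l}.
  by apply: continuousD; [exact: scalel_continuous|exact: cst_continuous].
have nearU : \forall w \near l 0, U w by rewrite l0; exact: open_nbhs_nbhs.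
have near1 : \forall w \near l 0, forall t : R, t \in `[0, 1] -> `|psi z t - psi w t| < 1.
  by rewrite l0; apply: near_section => // t; exact: cpsi.
have [e /= e0 He] : \forall h \near (0 : R), U (l h) /\
    forall t : R, t \in `[0, 1] -> `|psi z t - psi (l h) t| < 1.
  exact: (cl _ (filterI nearU near1)).
have {}He h : h \in `]-e, e[ -> U (l h) /\
    forall t : R, t \in `[0, 1] -> `|psi z t - psi (l h) t| < 1.
  by rewrite in_itv /= => he; apply: He; rewrite /= sub0r normrN ltr_norml.
have I0 : `]-e, e[%classic (0 : R) by rewrite /= in_itv /= oppr_lt0 e0.
have df (h t : R) : h \in `]-e, e[ -> t \in `[0, 1] ->
    is_derive h 1 (fun h => phi (l h) t) (psi (l h) t).
  by move=> /He[Uh _] t01; apply/(is_derive_lineP (phi^~ t)); exact: dphi.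
have d1f (h t : R) : h \in `]-e, e[ -> t \in `[0, 1] ->
    partial1of2 (fun h t => phi (l h) t) h t = psi (l h) t.
  by move=> hI t01; rewrite partial1of2E; have [] := df _ _ hI t01.
have intf (h : R) : `]-e, e[%classic h -> mu.-integrable `[0, 1] (EFin \o phi (l h)).
  by move=> /He[Uh _]; apply: integrable_section => t; exact: cphi.
have derf (h t : R) : `]-e, e[%classic h -> `[0, 1]%classic t ->
    derivable (fun h => phi (l h) t) h 1.
  by move=> hI t01; have [] := df _ _ hI t01.
(* Dominating function: for every [h] in the interval, [psi (l h) t] stays within 1 of [psi z t]. *)
pose G t := `|psi z t| + 1.
have G0 t : 0 <= G t by rewrite addr_ge0.
have iG : mu.-integrable `[0, 1] (EFin \o G).
  apply: continuous_compact_integrable; first exact: segment_compact.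
  apply: continuous_in_subspaceT => t; rewrite inE /= => t01.
  apply: cvgD; last exact: cvg_cst.
  by apply: cvg_norm; exact: (continuous_sectionr (cpsi z t Uz t01)).
have Gub (h t : R) : `]-e, e[%classic h -> `[0, 1]%classic t ->
    `|partial1of2 (fun h t => phi (l h) t) h t| <= G t.
  move=> hI t01; rewrite d1f// /G.
  have [_ /(_ t t01) /ltW] := He _ hI; rewrite distrC => le1.
  by rewrite -[psi (l h) t](subrK (psi z t)) addrC (le_trans (ler_normD _ _))// lerD2l.
pose f (h : R) t := phi (l h) t.
have D := @derivable_under_integral R _ _ mu f _ _ 0 _ _ I0 intf derf G G0 iG Gub.
have E := @differentiation_under_integral R _ _ mu f _ _ 0 _ _ I0 intf derf G G0 iG Gub.
rewrite -{1}l0; apply/(is_derive_lineP (fun w => int01 (phi w)) z v 0).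
split; first exact: D.
rewrite -derive1E E//; apply: eq_Rintegral => t; rewrite inE => t01.
by rewrite d1f// l0.
Qed.

End DerivativeUnderIntegral.

(** * Increments along segments as integrals of partial derivatives *)

Section Hadamard.
Variable R : realType.
Notation mu := (@lebesgue_measure R).

Lemma is_derive_line_scale (V : normedModType R) (f : V -> R) (a v : V) (c s : R) :
  derivable f ((c * s) *: v + a) v ->
  is_derive s 1 (fun h : R => f ((c * h) *: v + a)) (c * 'D_v f ((c * s) *: v + a)).
Proof.
move=> df.
have H1 : is_derive (c * s) 1 (fun h : R => f (h *: v + a)) ('D_v f ((c * s) *: v + a)).
  by apply/is_derive_lineP; split.
have H2 : is_derive s 1 (fun h : R => c * h) c.
  rewrite -[c in is_derive _ _ _ c]mulr1.
  exact: (is_deriveZ _ (is_derive_id s 1)).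
by rewrite mulrC; exact: (is_derive1_comp H1 H2).
Qed.

(** The fundamental theorem of calculus on [0, 1] for [F], whose derivative is [c] times the
    integrand. *)
Lemma integral_line (V : normedModType R) (f : V -> R) (a v : V) (c : R) :
  (forall t : R, t \in `[0, 1] -> derivable f ((c * t) *: v + a) v) ->
  (forall t : R, t \in `[0, 1] -> {for (c * t) *: v + a, continuous ('D_v f)}) ->
  f (c *: v + a) - f a = c * int01 (fun t => 'D_v f ((c * t) *: v + a)).
Proof.
move=> df cf.
pose F (t : R) := f ((c * t) *: v + a); pose D (t : R) := 'D_v f ((c * t) *: v + a).
have dF (t : R) : t \in `[0, 1] -> is_derive t 1 F (c * D t).
  by move=> /df; exact: is_derive_line_scale.
have cF (t : R) : t \in `[0, 1] -> {for t, continuous F}.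
  by move=> /dF [d _]; apply: differentiable_continuous; exact/derivable1_diffP.
have cD : {within `[0, 1], continuous D}.
  apply: continuous_in_subspaceT => t; rewrite inE /= => t01.
  apply: (continuous_comp (f := fun t : R => (c * t) *: v + a) _ (cf t t01)).
  apply: cvgD; last exact: cvg_cst.
  by apply: cvgZr_tmp; apply: cvgMr; exact: cvg_id.
have cDc : {within `[0, 1], continuous (fun t => c * D t)}.
  by move=> x; apply: cvgMr; exact: cD.
have iD : mu.-integrable `[0, 1] (EFin \o D).
  exact: (continuous_compact_integrable (@segment_compact _ _ _) cD).
have F01 : derivable_oo_LRcontinuous F 0 1.
  split.
  - by move=> t /subset_itv_oo_cc /dF [].
  - by apply: cvg_at_right_filter; apply: cF; rewrite in_itv /= lexx ler01.
  - by apply: cvg_at_left_filter; apply: cF; rewrite in_itv /= lexx ler01.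
have dFE : {in `]0, 1[, derive1 F =1 (fun t => c * D t)}.
  by move=> t /subset_itv_oo_cc /dF [_]; rewrite derive1E.
have := continuous_FTC2 ltr01 cDc F01 dFE.
rewrite /int01 -RintegralZl// /Rintegral => ->.
by rewrite /F mulr1 mulr0 scale0r add0r.
Qed.

Section Scaling.
Variables (U : set (R * R)) (al be : R -> R).
Hypotheses (openU : open U) (cal : continuous al) (cbe : continuous be).
Hypothesis scaleU : forall (z : R * R) (t : R),
  U z -> t \in `[0, 1] -> U (al t * z.1, be t * z.2).

Lemma continuous_scaled (g : R * R -> R) (w : R -> R) (z : R * R) (t : R) :
  continuous w -> {for (al t * z.1, be t * z.2), continuous g} ->
  {for (z, t), continuous (fun q : (R * R) * R =>
     w q.2 * g (al q.2 * q.1.1, be q.2 * q.1.2))}.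
Proof.
move=> cw cg.
have snd_comp (h : R -> R) : continuous h ->
    {for (z, t), continuous (fun q : (R * R) * R => h q.2)}.
  move=> ch; apply: (continuous_comp (f := snd) (g := h)); last exact: ch.
  exact: cvg_snd.
apply: cvgM; first exact: snd_comp.
pose S (q : (R * R) * R) : R * R := (al q.2 * q.1.1, be q.2 * q.1.2).
have cS : {for (z, t), continuous S}.
  apply: continuous_pair; apply: cvgM; try exact: snd_comp.
  - apply: (continuous_comp (f := fst) (g := fst)); first exact: cvg_fst.
    exact: cvg_fst.
  - apply: (continuous_comp (f := fst) (g := snd)); first exact: cvg_fst.
    exact: cvg_snd.
exact: (@continuous_comp _ _ _ S g (z, t) cS cg).
Qed.

(* Hadamard's lemma uses [(al t, be t) = (t, 1)] for the increment in x and
   [(0, t)] for the increment in lambda along x = 0. *)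
Definition int_scaled (w : R -> R) (g : R * R -> R) (z : R * R) : R :=
  int01 (fun t => w t * g (al t * z.1, be t * z.2)).

(** The equation involving [c] makes [v] an eigenvector of the scaling by [(al t, be t)] with
    eigenvalue [c t]; the chain rule contributes this factor to the weight. *)
Lemma is_derive_int_scaled (w c : R -> R) g (v z : R * R) :
  continuous w -> continuous c ->
  (forall (h t : R) (y : R * R), (al t * (h *: v + y).1, be t * (h *: v + y).2) =
     (c t * h) *: v + (al t * y.1, be t * y.2)) ->
  (forall y, U y -> {for y, continuous g}) ->
  (forall y, U y -> derivable g y v) ->
  (forall y, U y -> {for y, continuous ('D_v g)}) ->
  U z -> is_derive z v (int_scaled w g) (int_scaled (fun t => w t * c t) ('D_v g) z).
Proof.
move=> cw cc hv cg dg cdg Uz.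
pose phi (y : R * R) t := w t * g (al t * y.1, be t * y.2).
pose psi (y : R * R) t := w t * c t * 'D_v g (al t * y.1, be t * y.2).
apply: (@is_derive_int01 _ _ phi psi U v z openU Uz).
- move=> y t Uy t01.
  exact: (@continuous_scaled g _ y t cw (cg _ (scaleU Uy t01))).
- move=> y t Uy t01.
  have cwc : continuous (fun t => w t * c t).
    by move=> x; apply: cvgM; [exact: cw|exact: cc].
  exact: (@continuous_scaled ('D_v g) _ y t cwc (cdg _ (scaleU Uy t01))).
- move=> y t Uy t01; rewrite -[y]add0r -(scale0r v).
  apply/is_derive_lineP.
  rewrite /phi; under eq_fun do rewrite hv.
  rewrite /psi -mulrA scale0r add0r; apply: (is_deriveZ (w t)).
  have := @is_derive_line_scale _ g (al t * y.1, be t * y.2) v (c t) 0.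
  by rewrite mulr0 scale0r add0r; apply; apply: dg; exact: scaleU.
Qed.

(** The weight [w] varies in the induction: a derivative in x or lambda turns it into [w * al] or
    [w * be], so scaled integrals are stable under both partial derivatives. *)
Lemma Ck_int_scaled k (w : R -> R) g :
  continuous w -> Ck k U g -> Ck k U (int_scaled w g).
Proof.
elim: k w g => [|k IH] w g cw [cg Hg]; (split; first (move=> z Uz;
  apply: continuous_int01; apply: filterS (open_nbhs_nbhs (conj openU Uz)) => y Uy t t01;
  exact: (@continuous_scaled g w y t cw (cg _ (scaleU Uy t01))))) => //.
case: Hg => dg gx gl.
have Dx z : U z -> is_derive z (e_x R) (int_scaled w g)
    (int_scaled (fun t => w t * al t) ('D_(e_x R) g) z).
  apply: is_derive_int_scaled => //.
  - by move=> h t y; congr pair; rewrite /e_x /= /GRing.scale /=; ring.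
  - by move=> y /dg[].
  - exact: Ck_continuous gx.
have Dl z : U z -> is_derive z (e_lambda R) (int_scaled w g)
    (int_scaled (fun t => w t * be t) ('D_(e_lambda R) g) z).
  apply: is_derive_int_scaled => //.
  - by move=> h t y; congr pair; rewrite /e_lambda /= /GRing.scale /=; ring.
  - by move=> y /dg[].
  - exact: Ck_continuous gl.
have cM (c : R -> R) : continuous c -> continuous (fun t => w t * c t).
  by move=> cc x; apply: cvgM; [exact: cw|exact: cc].
split.
- by move=> z Uz; have [d1 _] := Dx z Uz; have [d2 _] := Dl z Uz.
- apply: (Ck_ext openU _ (IH _ _ (cM _ cal) gx)) => z Uz.
  by have [_] := Dx z Uz.
- apply: (Ck_ext openU _ (IH _ _ (cM _ cbe) gl)) => z Uz.
  by have [_] := Dl z Uz.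
Qed.

End Scaling.

(** The increment from the origin to (x, l) is split at the corner (0, l); on each leg the changing
    coordinate factors out of the integral. *)
Lemma hadamard (f : R * R -> R) : smooth_near0 f -> exists a b,
  [/\ smooth_near0 a, smooth_near0 b
    & \forall z \near ((0, 0) : R * R), f z = f (0, 0) + z.1 * a z + z.2 * b z].
Proof.
move=> [U [oU U0 sf]].
have /nbhs_ballP[r /= r0 rU] := open_nbhs_nbhs (conj oU U0).
(* A ball of the product is a square, hence stable under the two scalings; an arbitrary open [U]
   need not be. *)
pose V : set (R * R) := ball ((0, 0) : R * R) r.
have oV : open V by exact: ball_open.
have V0 : V (0, 0) by exact: ballxx.
have VP (z : R * R) : V z <-> `|z.1| < r /\ `|z.2| < r.
  by rewrite /V /ball /= /prod_ball /ball /= !sub0r !normrN.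
have sV k : Ck k V f by exact: (Ck_subset rU (sf k)).
have [_ [df _ _]] := sV 1%N.
have sx k : Ck k V ('D_(e_x R) f) by have [_ []] := sV k.+1.
have sl k : Ck k V ('D_(e_lambda R) f) by have [_ []] := sV k.+1.
have le_scale (t x : R) : t \in `[0, 1] -> `|x| < r -> `|t * x| < r.
  rewrite in_itv /= => /andP[t0 t1]; apply: le_lt_trans.
  by rewrite normrM ger0_norm// ler_piMl.
have scx (z : R * R) (t : R) : V z -> t \in `[0, 1] -> V (t * z.1, 1 * z.2).
  by move=> /VP[h1 h2] t01; apply/VP; rewrite /= mul1r; split=> //; exact: le_scale.
have scl (z : R * R) (t : R) : V z -> t \in `[0, 1] -> V (0 * z.1, t * z.2).
  move=> /VP[h1 h2] t01; apply/VP; rewrite /= mul0r normr0; split=> //.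
  exact: le_scale.
have c1 : continuous (fun _ : R => 1 : R) by exact: cst_continuous.
have c0 : continuous (fun _ : R => 0 : R) by exact: cst_continuous.
have cid : continuous (fun t : R => t) by move=> t; exact: cvg_id.
exists (int_scaled (fun t => t) (fun=> 1) (fun=> 1) ('D_(e_x R) f)).
exists (int_scaled (fun=> 0) (fun t => t) (fun=> 1) ('D_(e_lambda R) f)).
split.
- by exists V; split=> // k; exact: (Ck_int_scaled oV cid c1 scx c1 (sx k)).
- by exists V; split=> // k; exact: (Ck_int_scaled oV c0 cid scl c1 (sl k)).
apply: filterS (open_nbhs_nbhs (conj oV V0)) => -[x l] Vz /=.
(* These identities match the points of each segment in [integral_line] with the scaled points in
   [int_scaled]. *)
have ex t : (x * t) *: e_x R + (0, l) = (t * x, 1 * l).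
  by congr pair; rewrite /e_x /= /GRing.scale /=; ring.
have el t : (l * t) *: e_lambda R + (0, 0) = (0 * x, t * l).
  by congr pair; rewrite /e_lambda /= /GRing.scale /=; ring.
have Hx := @integral_line _ f (0, l) (e_x R) x.
have Hl := @integral_line _ f (0, 0) (e_lambda R) l.
have := ex 1; rewrite mulr1 !mul1r => ex1.
have := el 1; rewrite mulr1 mul0r mul1r => el1.
rewrite ex1 in Hx; rewrite el1 in Hl.
have {}Hx : f (x, l) - f (0, l) = x * int01 (fun t => 'D_(e_x R) f (t * x, 1 * l)).
  rewrite Hx; first by congr (_ * int01 _); apply/funext => t; rewrite ex.
  - by move=> t t01; rewrite ex; exact: (df _ (scx _ _ Vz t01)).1.
  - by move=> t t01; rewrite ex; apply: (Ck_continuous (sx 0%N)); exact: (scx _ _ Vz t01).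
have {}Hl : f (0, l) - f (0, 0) = l * int01 (fun t => 'D_(e_lambda R) f (0 * x, t * l)).
  rewrite Hl; first by congr (_ * int01 _); apply/funext => t; rewrite el.
  - by move=> t t01; rewrite el; exact: (df _ (scl _ _ Vz t01)).2.
  - by move=> t t01; rewrite el; apply: (Ck_continuous (sl 0%N)); exact: (scl _ _ Vz t01).
rewrite /int_scaled /=; under [in X in _ + x * X + _]eq_fun do rewrite mul1r.
under [in X in _ + l * X]eq_fun do rewrite mul1r.
by rewrite -Hx -Hl; ring.
Qed.

End Hadamard.

(** * Ideals relative to a subring *)

Section IdealTheory.
Variables (A : comNzRingType) (S : set A).
Hypothesis subringS : is_subring S.
Implicit Types (I G : set A).

Lemma subring1 : S 1. Proof. by case: subringS. Qed.

Lemma subringB a b : S a -> S b -> S (a - b).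
Proof. by case: subringS => _ + _; exact. Qed.

Lemma subringM a b : S a -> S b -> S (a * b).
Proof. by case: subringS => _ _; exact. Qed.

Lemma subring0 : S 0.
Proof. by rewrite -(subrr 1); exact: subringB subring1 subring1. Qed.

Lemma subringN a : S a -> S (- a).
Proof. by rewrite -sub0r; exact: subringB subring0. Qed.

Lemma subringD a b : S a -> S b -> S (a + b).
Proof. by move=> Sa Sb; rewrite -[b]opprK; apply/subringB/subringN. Qed.

Lemma subring_sum (T : finType) (f : T -> A) :
  (forall i, S (f i)) -> S (\sum_i f i).
Proof. by move=> Sf; apply: big_ind => //; [exact: subring0|exact: subringD]. Qed.

Lemma subringX a n : S a -> S (a ^+ n).
Proof.
move=> Sa; elim: n => [|n IH]; first by rewrite expr0; exact: subring1.
by rewrite exprS; exact: subringM.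
Qed.

Lemma subring_det n (B : 'M[A]_n) : (forall i j, S (B i j)) -> S (\det B).
Proof.
move=> SB; apply: subring_sum => s; apply: subringM.
  exact/subringX/subringN/subring1.
by apply: big_ind => //; [exact: subring1|exact: subringM].
Qed.

Lemma ideal_sum I (T : finType) (f : T -> A) :
  is_ideal S I -> (forall i, I (f i)) -> I (\sum_i f i).
Proof. by move=> [_ I0 ID _] If; apply: big_ind. Qed.

Lemma idealN I a : is_ideal S I -> I a -> I (- a).
Proof.
move=> [_ _ _ IM] Ia; rewrite -mulN1r; apply: IM => //.
exact/subringN/subring1.
Qed.

Lemma sub_ideal_gen G : G `<=` ideal_gen S G.
Proof. exact: sub_gen_smallest. Qed.

Lemma ideal_gen_subP G I : is_ideal S I -> (ideal_gen S G `<=` I <-> G `<=` I).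
Proof.
move=> idI; split=> [GI|GI]; first exact: subset_trans (@sub_ideal_gen G) GI.
exact: smallest_sub.
Qed.

Lemma ideal_gen_full G : G `<=` S -> G 1 -> ideal_gen S G = S.
Proof.
move=> GS G1; have [sub _ _ IM] := ideal_genP subringS GS.
apply/seteqP; split=> // a Sa; rewrite -[a]mulr1; apply: IM => //.
exact: sub_ideal_gen.
Qed.

(** Colon ideals extend membership of products from generators to whole ideals, one factor at a
    time. *)
Lemma ideal_colon c I : S c -> is_ideal S I -> is_ideal S [set a | S a /\ I (c * a)].
Proof.
move=> Sc [sub I0 ID IM]; split.
- by move=> a [].
- by split; [exact: subring0|rewrite mulr0].
- by move=> a b [Sa Ia] [Sb Ib]; split; [exact: subringD|rewrite mulrDr; exact: ID].
- by move=> s a Ss [Sa Ia]; split; [exact: subringM|rewrite mulrCA; exact: IM].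
Qed.

Lemma ideal_mul_gen G1 G2 : G1 `<=` S -> G2 `<=` S ->
  ideal_mul S (ideal_gen S G1) (ideal_gen S G2) =
  ideal_gen S [set c | exists a b, [/\ G1 a, G2 b & c = a * b]].
Proof.
move=> G1S G2S; set G := [set c | _].
have GS : G `<=` S.
  by move=> _ [a [b [/G1S Sa /G2S Sb ->]]]; exact: subringM.
have idG := ideal_genP subringS GS.
have id1 := ideal_genP subringS G1S; have id2 := ideal_genP subringS G2S.
have [sub1 _ _ _] := id1; have [sub2 _ _ _] := id2.
apply/seteqP; split.
- apply/(ideal_gen_subP _ idG) => _ [a [b [Ia Ib ->]]].
  (* With the first factor a generator, the second runs over its whole ideal; then the first factor
     is freed in the same way. *)
  have H c : G1 c -> ideal_gen S G2 `<=` [set d | S d /\ ideal_gen S G (c * d)].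
    move=> Gc; apply/ideal_gen_subP; first exact/ideal_colon/idG/G1S.
    move=> d Gd; split; first exact: G2S.
    by apply: sub_ideal_gen; exists c, d.
  have : ideal_gen S G1 `<=` [set c | S c /\ ideal_gen S G (b * c)].
    apply/ideal_gen_subP; first exact/ideal_colon/idG/sub2.
    move=> c Gc; split; first exact: G1S.
    by rewrite mulrC; have [] := H c Gc b Ib.
  by move=> /(_ a Ia) [_]; rewrite mulrC.
- apply/ideal_gen_subP.
    apply: ideal_genP => // _ [a [b [/sub1 Sa /sub2 Sb ->]]]; exact: subringM.
  move=> _ [a [b [Ga Gb ->]]]; apply: sub_ideal_gen; exists a, b.
  by split=> //; exact: sub_ideal_gen.
Qed.

(** The combinations form an ideal containing each [g l] (with Kronecker delta coefficients), so
    minimality of the generated ideal gives the existence of [s]. *)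
Lemma ideal_gen_rangeP n (g : 'I_n -> A) (h : A) : (forall l, S (g l)) ->
  ideal_gen S (range g) h <->
  exists s : 'I_n -> A, (forall l, S (s l)) /\ h = \sum_l s l * g l.
Proof.
move=> Sg; have idg : is_ideal S (ideal_gen S (range g)).
  by apply: ideal_genP => // _ [l _ <-].
split=> [|[s [Ss ->]]]; last first.
  apply: ideal_sum => // l; case: idg => _ _ _; apply => //.
  by apply: sub_ideal_gen; exists l.
apply: (iffRL (@ideal_gen_subP (range g)
  [set h | exists s : 'I_n -> A, (forall l, S (s l)) /\ h = \sum_l s l * g l] _)).
- split.
  + move=> _ [s [Ss ->]]; apply: subring_sum => l; exact: subringM.
  + exists (fun=> 0); split; first by move=> _; exact: subring0.
    by rewrite big1// => l _; rewrite mul0r.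
  + move=> _ _ [s [Ss ->]] [r [Sr ->]]; exists (fun l => s l + r l).
    split; first by move=> l; exact: subringD.
    by rewrite -big_split; apply: eq_bigr => l _; rewrite mulrDl.
  + move=> c _ Sc [s [Ss ->]]; exists (fun l => c * s l).
    split; first by move=> l; exact: subringM.
    by rewrite mulr_sumr; apply: eq_bigr => l _; rewrite mulrA.
- move=> _ [l _ <-]; exists (fun m => (m == l)%:R); split.
    by move=> m; case: eqP => _; [exact: subring1|exact: subring0].
  rewrite (bigD1 l)//= eqxx mul1r big1 ?addr0// => m /negPf ->.
  by rewrite mul0r.
Qed.

(* Cramer's rule: multiplying [(1 - C) m = q] by the adjugate of [1 - C] gives
   [\det (1 - C) m = \adj (1 - C) q]. *)
Lemma nakayama I n (C : 'M[A]_n) (m q : 'I_n -> A) (u : A) :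
  is_ideal S I -> (forall i j, S (C i j)) -> (forall i, I (q i)) ->
  (forall i, m i = q i + \sum_j C i j * m j) ->
  S u -> u * \det (1%:M - C) = 1 -> forall i, I (m i).
Proof.
move=> idI SC Iq mE Su uE i; have [_ _ _ IM] := idI.
pose B := 1%:M - C.
have SB k l : S (B k l).
  rewrite !mxE; apply: subringB => //.
  by case: eqP => _; [exact: subring1|exact: subring0].
have BE : B *m (\col_j m j) = \col_j q j.
  apply/colP => k; rewrite mulmxBl mul1mx !mxE {1}mE.
  by under [in X in _ - X]eq_bigr do rewrite mxE; rewrite addrK.
have dE : \det B *: (\col_j m j) = \adj B *m (\col_j q j).
  by rewrite -BE mulmxA mul_adj_mx mul_scalar_mx.
move/colP/(_ i): dE; rewrite !mxE => dE.
rewrite -[m i]mul1r -uE -mulrA dE; apply: (IM) => //; apply: ideal_sum => // j.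
rewrite !mxE; apply: IM => //; apply: subringM.
  exact/subringX/subringN/subring1.
by apply: subring_det => k l; rewrite 2!mxE; exact: SB.
Qed.

End IdealTheory.

(** * Monomial generators of the powers of an ideal with two generators *)

Section Monomials.
Variables (A : comNzRingType) (x y : A).

(** The index is the exponent of [x], so ['I_k.+1] enumerates the monomials of degree k. *)
Definition monomial (k : nat) (a : 'I_k.+1) : A := x ^+ a * y ^+ (k - a).

Lemma monomialMx k (a : 'I_k.+1) :
  x * monomial a = monomial (lift ord0 a).
Proof. by rewrite /monomial lift0 exprS -mulrA. Qed.

Lemma monomialMy k (a : 'I_k.+1) :
  y * monomial a = monomial (widen_ord (leqnSn k.+1) a).
Proof. by rewrite /monomial /= subSn ?exprS; [rewrite mulrCA|rewrite -ltnS]. Qed.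

(** A positive exponent of [x] lets [x] be split off; exponent 0 leaves a pure positive power of
    [y]. *)
Lemma monomialS k (b : 'I_k.+2) : exists a : 'I_k.+1,
  monomial b = x * monomial a \/ monomial b = y * monomial a.
Proof.
case: (unliftP ord0 b) => [a ->|->]; first by exists a; left; rewrite monomialMx.
exists ord0; right; rewrite monomialMy; congr monomial; exact: val_inj.
Qed.

Section Subring.
Variable S : set A.
Hypotheses (subringS : is_subring S) (Sx : S x) (Sy : S y).

Lemma subring_monomial k (a : 'I_k.+1) : S (monomial a).
Proof. by apply: subringM => //; apply: subringX. Qed.

(** Products of [x] or [y] with the monomials of degree k are exactly those of degree k + 1. In
    degree 0 the only monomial is 1, in accordance with the power 0 being [S]. *)
Lemma ideal_exp_monomial k :
  ideal_exp S (ideal_gen S [set x; y]) k = ideal_gen S (range (@monomial k)).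
Proof.
elim: k => [|k IH].
  rewrite [RHS]ideal_gen_full//; last first.
    by exists ord0 => //; rewrite /monomial !expr0 mulr1.
  by move=> _ [a _ <-]; exact: subring_monomial.
rewrite -[LHS]/(ideal_mul S _ (ideal_exp _ _ _)) IH ideal_mul_gen//; last first.
- by move=> _ [a _ <-]; exact: subring_monomial.
- by move=> _ [->|->].
congr ideal_gen; apply/seteqP; split.
- move=> _ [_ [_ [[->|->] [a _ <-] ->]]].
    by rewrite monomialMx; exists (lift ord0 a).
  by rewrite monomialMy; exists (widen_ord (leqnSn k.+1) a).
- move=> _ [b _ <-]; have [a [->|->]] := monomialS b.
    by exists x, (monomial a); split=> //; left.
  by exists y, (monomial a); split=> //; right.
Qed.

Lemma ideal_exp_mul_monomial i (c : A) : S c ->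
  ideal_mul S (ideal_exp S (ideal_gen S [set x; y]) i) (ideal_gen S [set c]) =
  ideal_gen S (range (fun a : 'I_i.+1 => monomial a * c)).
Proof.
move=> Sc; rewrite ideal_exp_monomial ideal_mul_gen//; last 2 first.
- by move=> _ [a _ <-]; exact: subring_monomial.
- by move=> _ ->.
congr ideal_gen; apply/seteqP; split.
- by move=> _ [_ [_ [[a _ <-] -> ->]]]; exists a.
- by move=> _ [a _ <-]; exists (monomial a), c; split.
Qed.

End Subring.
End Monomials.

(** * Germs *)

Section GermEval.
Variable R : realType.
Implicit Types (f g : R * R -> R) (h : germ_ring R).

(** The choice of [repr] is immaterial, since functions equal near the origin are equal at it. As a
    ring morphism, [ev] later commutes with determinants. *)
Definition ev h : R := repr h (0, 0).

Lemma ev_germ f : ev (germ f) = f (0, 0).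
Proof.
have /germP/nbhs_singleton := reprK (germ f : {ideal_quot (@vanishes_near0 R)}).
exact.
Qed.

Lemma germ_repr h : exists f, h = germ f.
Proof. by exists (repr h); rewrite [RHS]reprK. Qed.

Lemma germD f g : germ (f + g) = germ f + germ g.
Proof. exact: rmorphD. Qed.

Fact ev_is_zmod_morphism : zmod_morphism ev.
Proof.
move=> a b; have [[f ->] [g ->]] := (germ_repr a, germ_repr b).
by rewrite -germB !ev_germ.
Qed.

Fact ev_is_monoid_morphism : monoid_morphism ev.
Proof.
split; first by rewrite -germ1 ev_germ.
move=> a b; have [[f ->] [g ->]] := (germ_repr a, germ_repr b).
by rewrite -germM !ev_germ.
Qed.

HB.instance Definition _ :=
  GRing.isZmodMorphism.Build (germ_ring R) R ev ev_is_zmod_morphism.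
HB.instance Definition _ :=
  GRing.isMonoidMorphism.Build (germ_ring R) R ev ev_is_monoid_morphism.

Definition germ_cst (c : R) : germ_ring R := germ (cst c).

Lemma ev_x : ev (x_germ R) = 0. Proof. exact: ev_germ. Qed.

Lemma ev_lambda : ev (lambda_germ R) = 0. Proof. exact: ev_germ. Qed.

Lemma germ_monomial k (a : 'I_k.+1) :
  monomial (x_germ R) (lambda_germ R) a =
  germ (fun z => z.1 ^+ a * z.2 ^+ (k - a)).
Proof.
have germX f n : germ f ^+ n = germ (fun z => f z ^+ n).
  elim: n => [|n IH]; first by rewrite expr0 -germ1.
  by rewrite exprS IH -germM; congr germ; apply/funext => z; rewrite exprS.
by rewrite /monomial !germX -germM.
Qed.

Lemma germ_sum (T : finType) (f : T -> R * R -> R) :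
  \sum_i germ (f i) = germ (fun z => \sum_i f i z).
Proof.
have -> : (fun z => \sum_i f i z) = \sum_i f i.
  by apply/funext => z; rewrite fct_sumE.
by rewrite (big_morph _ germD (rmorph0 (\pi_({ideal_quot (@vanishes_near0 R)})))).
Qed.

End GermEval.

(** Otherwise the naturals below [size p] would be more distinct roots than the degree allows. *)
Lemma poly_horner_eq0 (R : realType) (p : {poly R}) : (forall u, p.[u] = 0) -> p = 0.
Proof.
move=> p0; apply/eqP; apply: contraT => np0.
have := @max_poly_roots _ p [seq i%:R | i <- iota 0 (size p)] np0.
rewrite size_map size_iota ltnn; apply.
  by apply/allP => u _; apply/rootP.
rewrite map_inj_uniq ?iota_uniq// => i j /eqP.
by rewrite eqr_nat => /eqP.
Qed.

(** * Rings of germs closed under first-order Taylor expansion *)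

Section TaylorSubrings.
Variable R : realType.
Notation E := (smooth_germs R).
Notation xg := (x_germ R).
Notation yg := (lambda_germ R).
Notation mono := (monomial xg yg).
Notation F := (frac_germs R).
Notation P := (poly_germs R).
Notation M S k := (ideal_exp S (max_ideal S) k).

(** The common interface of the three rings. The essential clause is that the expansion coefficients
    [a], [b] stay in [S], so that expansions can be iterated there. *)
Definition taylor_subring (S : set (germ_ring R)) : Prop :=
  [/\ is_subring S, S `<=` E, (forall c, S (germ_cst c)), S xg /\ S yg
    & forall h, S h -> exists a b,
        [/\ S a, S b & h = germ_cst (ev h) + xg * a + yg * b]].

Lemma germ_cst0 : germ_cst (0 : R) = 0.
Proof. exact: (rmorph0 (\pi_({ideal_quot (@vanishes_near0 R)}))). Qed.

Lemma smooth_continuous0 (f : R * R -> R) :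
  smooth_near0 f -> {for (0, 0), continuous f}.
Proof. by move=> [U [_ U0 /(_ 0%N) [cf _]]]; exact: cf. Qed.

(* On the line z = (t u, t) a form of degree k is t ^ k times a polynomial in u,
   while elements of the (k + 1)-st power are O(t ^ (k + 1)). *)
Lemma homogeneous_in_exp k (c : 'I_k.+1 -> R) :
  M E k.+1 (\sum_a germ_cst (c a) * mono a) -> forall a, c a = 0.
Proof.
have sE := smooth_germs_subring R.
have Ex : E xg by exact/frac_germs_smooth/poly_germs_frac/x_germ_poly.
have Ey : E yg by exact/frac_germs_smooth/poly_germs_frac/lambda_germ_poly.
rewrite ideal_exp_monomial// => /ideal_gen_rangeP[] //.
  by move=> l; exact: subring_monomial.
move=> e [Ee He].
have /choice[f Hf] : forall b, exists f, smooth_near0 f /\ e b = germ f.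
  by move=> b; have [f sf <-] := Ee b; exists f.
have {He} : \forall z \near ((0, 0) : R * R),
    \sum_a c a * (z.1 ^+ a * z.2 ^+ (k - a)) =
    \sum_(b < k.+2) f b z * (z.1 ^+ b * z.2 ^+ (k.+1 - b)).
  apply/germP; rewrite -!germ_sum; move: He.
  under eq_bigr do rewrite germ_monomial -germM.
  under [in X in _ = X -> _]eq_bigr => b _ do rewrite germ_monomial (Hf b).2 -germM.
  exact.
move=> nearE.
(* The dehomogenized form: its value at [u] is that of the form at (u, 1). *)
pose p : {poly R} := \poly_(a < k.+1) c (inord a).
suff p0 : p = 0.
  move=> a; have := coef_poly k.+1 (fun a => c (inord a)) a.
  by rewrite -/p p0 coef0 ltn_ord inord_val.
apply: poly_horner_eq0 => u.
pose l (t : R) : R * R := (t * u, t).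
have cl : {for 0, continuous l}.
  apply: (@cvg_pair _ _ _ (nbhs (0 : R)) (nbhs (0 * u)) (nbhs (0 : R))).
    by apply: cvgMl; exact: cvg_id.
  exact: cvg_id.
have homog (t : R) n m : (m <= n)%N -> (t * u) ^+ m * t ^+ (n - m) = t ^+ n * u ^+ m.
  by move=> mn; rewrite exprMn mulrAC -exprD subnKC.
pose G (t : R) := \sum_(b < k.+2) f b (l t) * u ^+ b.
have cG : {for 0, continuous (fun t : R => t * G t)}.
  apply: cvgM; first exact: cvg_id.
  apply: cvg_big => [|b _]; [exact: add_continuous|apply: cvgMl].
  have l0 : l 0 = (0, 0) by rewrite /l mul0r.
  have cf : {for l 0, continuous (f b)}.
    by rewrite l0; exact: smooth_continuous0 (Hf b).1.
  exact: (@continuous_comp _ _ _ l (f b) 0 cl cf).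
have l0 : l 0 = (0, 0) by rewrite /l mul0r.
rewrite -l0 in nearE.
have nearEl := cl _ nearE.
(* For nonzero [t], cancelling [t ^+ k] shows [t * G t] equal to [p.[u]]; by continuity it also
   tends to 0, so [p.[u]] is 0. *)
have : t * G t @[t --> (0 : R)^'] --> p.[u].
  apply: (@cvg_trans _ (cst p.[u] @ (0 : R)^')); last exact: cvg_cst.
  apply: near_eq_cvg; near=> t.
  have t0 : t != 0 by near: t; exact: nbhs_dnbhs_neq.
  have : \sum_a c a * ((l t).1 ^+ a * (l t).2 ^+ (k - a)) =
    \sum_(b < k.+2) f b (l t) * ((l t).1 ^+ b * (l t).2 ^+ (k.+1 - b)).
    by near: t; exact: nbhs_dnbhs.
  have -> : \sum_a c a * ((l t).1 ^+ a * (l t).2 ^+ (k - a)) = t ^+ k * p.[u].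
    rewrite horner_poly mulr_sumr; apply: eq_bigr => a _.
    by rewrite inord_val (homog _ _ _ (leq_ord a)) mulrCA.
  have -> : \sum_(b < k.+2) f b (l t) * ((l t).1 ^+ b * (l t).2 ^+ (k.+1 - b)) =
      t ^+ k * (t * G t).
    rewrite mulrA -exprSr mulr_sumr; apply: eq_bigr => b _.
    by rewrite (homog _ _ _ (leq_ord b)) mulrCA.
  by move/(mulfI (expf_neq0 _ t0)).
have : t * G t @[t --> (0 : R)^'] --> (0 : R).
  have := cG; rewrite /prop_for /continuous_at mul0r => H.
  apply: cvg_trans H; apply: cvg_app; exact: nbhs_dnbhs.
move=> h1 h2; exact: (cvg_unique _ h2 h1).
Unshelve. all: by end_near.
Qed.

Lemma poly_germ_cst (c : R) : P (germ_cst c).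
Proof. by exists c%:P%:P => //; rewrite poly_fun0. Qed.

Lemma smooth_taylor : taylor_subring E.
Proof.
have PE : P `<=` E by move=> h /poly_germs_frac /frac_germs_smooth.
split=> //; first exact: smooth_germs_subring.
- by move=> c; exact/PE/poly_germ_cst.
- by split; apply: PE; [exact: x_germ_poly|exact: lambda_germ_poly].
- move=> _ [f sf <-]; have [a [b [sa sb fE]]] := hadamard sf.
  exists (germ a), (germ b); split; [by exists a|by exists b|].
  by rewrite ev_germ /germ_cst /x_germ /lambda_germ -!germM -!germD; apply/germP.
Qed.

Lemma poly_taylor : taylor_subring P.
Proof.
split.
- exact: poly_germs_subring.
- by move=> h /poly_germs_frac /frac_germs_smooth.
- exact: poly_germ_cst.
- by split; [exact: x_germ_poly|exact: lambda_germ_poly].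
move=> _ [p _ <-].
(* Division by x, then division of the remainder by lambda: the two quotients are the sought [a] and
   [b]. *)
elim/poly_ind: p => [|p c _].
  exists 0, 0; have P0 := subring0 (poly_germs_subring R); split=> //.
  by rewrite /poly_fun; under eq_fun do rewrite !horner0; rewrite ev_germ !mulr0 !addr0.
elim/poly_ind: c => [|c a _].
  exists (germ (poly_fun p)), 0.
  split; [by exists p|exact: subring0 (poly_germs_subring R)|].
  rewrite mulr0 !addr0 /germ_cst /x_germ ev_germ -germM -germD;
  congr germ; apply/funext => z.
  rewrite -[RHS]/(_ + z.1 * poly_fun p z) /poly_fun /=.
  by rewrite !hornerE /=; ring.
exists (germ (poly_fun p)), (germ (poly_fun c%:P)); split; [by exists p|by exists c%:P|].
rewrite /germ_cst /x_germ /lambda_germ ev_germ -!germM -!germD;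
congr germ; apply/funext => z.
rewrite -[RHS]/(_ + z.1 * poly_fun p z + z.2 * poly_fun c%:P z) /poly_fun /=.
by rewrite !hornerE /=; ring.
Qed.

(** The swapped quotient is again a fractional germ, and the product is 1 wherever numerator and
    denominator are both nonzero, hence near the origin. *)
Lemma frac_germ_inv h : F h -> ev h != 0 -> exists2 k, F k & k * h = 1.
Proof.
move=> [p [q [q0 ->]]]; rewrite ev_germ mulf_eq0 invr_eq0 negb_or => /andP[p0 _].
exists (germ (fun z => poly_fun q z / poly_fun p z)); first by exists q, p.
rewrite -germM -germ1; apply/germP.
have near0 r : poly_fun r (0, 0) != 0 ->
    \forall z \near ((0, 0) : R * R), poly_fun r z != 0.
  by move=> r0; apply: open_nbhs_nbhs; split=> //; exact: open_poly_fun_neq0.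
apply: filterS2 (near0 p p0) (near0 q q0) => z pz qz.
rewrite -[LHS]/(_ / _ * (_ / _)) -[RHS]/(1 : R).
by field; rewrite pz qz.
Qed.

Lemma frac_taylor : taylor_subring F.
Proof.
have sF := frac_germs_subring R.
have FP := @poly_germs_frac R.
split=> //.
- exact: frac_germs_smooth.
- by move=> c; exact/FP/poly_germ_cst.
- by split; apply: FP; [exact: x_germ_poly|exact: lambda_germ_poly].
move=> h Fh; have [p [q [q0 hE]]] := Fh.
have Fq : F (germ (poly_fun q)) by apply: FP; exists q.
have evq : ev (germ (poly_fun q)) != 0 by rewrite ev_germ.
have [k Fk kq] := frac_germ_inv Fq evq.
have [_ _ Pc _ Pt] := poly_taylor.
(* The numerator of [h] minus its value at the origin, over the denominator [q]. It is polynomial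
   and vanishes at the origin, so its expansion can be divided by [q]. *)
pose d := germ (poly_fun p) - germ_cst (ev h) * germ (poly_fun q).
have sP := poly_germs_subring R.
have Pd : P d.
  by apply: subringB => //; [exists p|apply: subringM => //; exists q].
have hq : h * germ (poly_fun q) = germ (poly_fun p).
  rewrite hE -germM; apply/germP.
  apply: filterS (open_nbhs_nbhs (conj (@open_poly_fun_neq0 R q) q0)) => z qz.
  by rewrite -[LHS]/(_ / _ * _) divfK.
have evd : ev d = 0.
  rewrite rmorphB rmorphM /= -hq rmorphM /= {1}/germ_cst [ev (germ (cst _))]ev_germ /=.
  by rewrite subrr.
have [a [b [Pa Pb dE]]] := Pt d Pd.
move: dE; rewrite evd germ_cst0 add0r => dE.
exists (k * a), (k * b); split;
  [by apply: subringM => //; exact: FP|by apply: subringM => //; exact: FP|].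
have {1}-> : h = germ_cst (ev h) + k * d.
  by rewrite /d mulrBr -hq ![k * (_ * _)]mulrCA kq !mulr1 addrC subrK.
by rewrite dE; ring.
Qed.

(** * Powers of the maximal ideal in one such ring *)

Section Subring.
Variable S : set (germ_ring R).
Hypothesis tS : taylor_subring S.

Let sS : is_subring S. Proof. by case: tS. Qed.
Let SE : S `<=` E. Proof. by case: tS. Qed.
Let Sx : S xg. Proof. by case: tS => _ _ _ []. Qed.
Let Sy : S yg. Proof. by case: tS => _ _ _ []. Qed.

Lemma taylor_expP k h : M S k h <->
  exists s : 'I_k.+1 -> germ_ring R, (forall a, S (s a)) /\ h = \sum_a s a * mono a.
Proof.
rewrite ideal_exp_monomial//; apply: ideal_gen_rangeP => // a.
exact: subring_monomial.
Qed.

Lemma exp_ideal k : is_ideal S (M S k).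
Proof.
rewrite ideal_exp_monomial//; apply: ideal_genP => // _ [a _ <-].
exact: subring_monomial.
Qed.

Lemma exp_subP k I : is_ideal S I -> (M S k `<=` I <-> forall a : 'I_k.+1, I (mono a)).
Proof.
move=> idI; rewrite ideal_exp_monomial//.
by split=> [/ideal_gen_subP/(_ _)|]; [move=> H a; apply: H => //; exists a
  |move=> H; apply/ideal_gen_subP => // _ [a _ <-]].
Qed.

Lemma exp_monomial k (a : 'I_k.+1) : M S k (mono a).
Proof. by rewrite ideal_exp_monomial//; apply: sub_ideal_gen; exists a. Qed.

Lemma expS_sub k : M S k.+1 `<=` M S k.
Proof.
have idM := exp_ideal k; apply/exp_subP => // b.
have [_ _ _ IM] := idM.
by have [a [->|->]] := monomialS xg yg b; apply: IM => //; exact: exp_monomial.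
Qed.

Lemma ideal_setIE I : is_ideal E I -> is_ideal S (I `&` S).
Proof.
move=> [sub I0 ID IM]; split.
- by move=> a [].
- by split=> //; exact: subring0.
- by move=> a b [Ia Sa] [Ib Sb]; split; [exact: ID|exact: subringD].
- by move=> s a Ss [Ia Sa]; split; [apply: IM => //; exact: SE|exact: subringM].
Qed.

(** The condition on monomials does not mention [S], which makes the inclusions in the three rings
    equivalent. *)
Lemma exp_sub_smoothP k I : is_ideal E I ->
  (M S k `<=` I `&` S <-> forall a : 'I_k.+1, I (mono a)).
Proof.
move=> idI; rewrite exp_subP; last exact: ideal_setIE.
by split=> H a; [have [] := H a|split=> //; exact: subring_monomial].
Qed.

(** The constants are the values of [s a] at the origin; the rest of each coefficient carries a
    factor x or lambda, raising the degree by one. *)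
Lemma taylor_split k (s : 'I_k.+1 -> germ_ring R) : (forall a, S (s a)) ->
  exists c : 'I_k.+1 -> R,
    M S k.+1 (\sum_a s a * mono a - \sum_a germ_cst (c a) * mono a).
Proof.
move=> Ss; exists (fun a => ev (s a)); rewrite -sumrB.
have idM := exp_ideal k.+1; apply: ideal_sum (idM) _ => a.
have [_ _ _ _ St] := tS.
have [p [q [Sp Sq E1]]] := St _ (Ss a).
have -> : s a * mono a - germ_cst (ev (s a)) * mono a =
    p * (xg * mono a) + q * (yg * mono a) by rewrite {1}E1; ring.
have [_ _ ID IM] := idM.
by rewrite monomialMx monomialMy; apply: ID; apply: IM => //; exact: exp_monomial.
Qed.

Lemma mul_lambda_subP i j I : is_ideal S I ->
  (ideal_mul S (M S i) (ideal_gen S [set yg ^+ j]) `<=` I <->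
   forall a : 'I_i.+1, I (mono a * yg ^+ j)).
Proof.
move=> idI; rewrite ideal_exp_mul_monomial//; last exact: subringX.
split=> [H a|H]; last by apply/ideal_gen_subP => // _ [a _ <-].
by apply: H; apply: sub_ideal_gen; exists a.
Qed.

Lemma germ_gen_ideal n (g : 'I_n -> germ_ring R) :
  (forall l, S (g l)) -> is_ideal S (ideal_gen S (range g)).
Proof. by move=> Sg; apply: ideal_genP => // _ [l _ <-]. Qed.

End Subring.

(** * Descent from smooth germs to a smaller ring *)

Section Comparison.
Variable S : set (germ_ring R).
Hypothesis tS : taylor_subring S.

Let sS : is_subring S. Proof. by case: tS. Qed.
Let SE : S `<=` E. Proof. by case: tS. Qed.
Let Sc c : S (germ_cst c). Proof. by case: tS. Qed.
Let Sx : S xg. Proof. by case: tS => _ _ _ []. Qed.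
Let Sy : S yg. Proof. by case: tS => _ _ _ []. Qed.
Let tE := smooth_taylor.
Let sE := smooth_germs_subring R.

Lemma exp_smooth k : M S k `<=` M E k.
Proof.
suff H : M S k `<=` M E k `&` S by move=> h /H [].
by apply/(exp_sub_smoothP tS k (exp_ideal tE k)) => a; exact: exp_monomial.
Qed.

(** By induction, [h] is a form with constant coefficients modulo the next power over [S]. The form
    then lies in that power over [E], so [homogeneous_in_exp] kills it. *)
Lemma exp_smoothI k h : S h -> M E k h -> M S k h.
Proof.
move=> Sh; elim: k => [|k IH] Eh; first exact: Sh.
have /(taylor_expP tS)[s [Ss hE]] := IH (expS_sub tE Eh).
have [c hc] := taylor_split tS Ss; rewrite -hE in hc.
have c0 : forall a, c a = 0.
  apply: homogeneous_in_exp.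
  have [_ _ ID _] := exp_ideal tE k.+1.
  have -> : \sum_a germ_cst (c a) * mono a =
      h + - (h - \sum_a germ_cst (c a) * mono a) by ring.
  by apply: ID => //; apply: (idealN sE (exp_ideal tE _)); exact: exp_smooth.
by move: hc; rewrite big1 ?subr0// => a _; rewrite c0 germ_cst0 mul0r.
Qed.

(** The Taylor polynomial is built one degree at a time; [S] contains it because it contains the
    constants and both coordinates. *)
Lemma smooth_approx k h : E h -> exists2 p, S p & M E k (h - p).
Proof.
move=> Eh; elim: k => [|k [p Sp /(taylor_expP tE)[s [Es hE]]]].
  by exists 0; [exact: subring0|rewrite subr0].
have [c hc] := taylor_split tE Es; rewrite -hE in hc.
exists (p + \sum_a germ_cst (c a) * mono a); last by rewrite opprD addrA.
apply: subringD => //; apply: subring_sum => // a.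
by apply: subringM => //; exact: subring_monomial.
Qed.

Section Generators.
Variables (n : nat) (g : 'I_n -> germ_ring R).
Hypothesis Sg : forall l, S (g l).
Notation gen S := (ideal_gen S (range g)).

Let Eg l : E (g l). Proof. exact: SE. Qed.

Lemma gen_smooth : gen S `<=` gen E.
Proof.
have H : gen S `<=` gen E `&` S.
  apply/ideal_gen_subP; first exact: (ideal_setIE tS (germ_gen_ideal tE Eg)).
  by move=> _ [l _ <-]; split=> //; apply: sub_ideal_gen; exists l.
by move=> h /H [].
Qed.

(** Approximating each coefficient of [h] from [S] leaves an error in the k-th power over [E]; the
    error also lies in [S], so [exp_smoothI] applies. *)
Lemma gen_approx k h : S h -> gen E h -> exists2 p, gen S p & M S k (h - p).
Proof.
move=> Sh /ideal_gen_rangeP[]// s [Es hE].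
have /choice[p /all_and2[Sp Hp]] : forall l, exists p, S p /\ M E k (s l - p).
  by move=> l; have [p ? ?] := smooth_approx k (Es l); exists p.
have genp : gen S (\sum_l p l * g l) by apply/ideal_gen_rangeP => //; exists p.
exists (\sum_l p l * g l) => //; apply: exp_smoothI.
  apply: subringB => //; apply: subring_sum => // l; exact: subringM.
rewrite hE -sumrB; apply: (ideal_sum (exp_ideal tE k)) => l.
rewrite -mulrBl mulrC; have [_ _ _ IM] := exp_ideal tE k.
exact: IM.
Qed.

Lemma gen_descent k h : M S k `<=` gen S -> S h -> gen E h -> gen S h.
Proof.
move=> Mk Sh /(gen_approx k Sh)[p gp /Mk gr].
have [_ _ ID _] := germ_gen_ideal tS Sg.
by rewrite -[h](subrK p); exact: ID.
Qed.

End Generators.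
End Comparison.

(* Nakayama: a monomial of degree k is congruent, modulo the ideal in the ring of
   fractions, to a combination of such monomials with coefficients vanishing at
   the origin, and fractional germs not vanishing there are units. *)
Lemma exp_sub_gen_frac n (g : 'I_n -> germ_ring R) k : (forall l, F (g l)) ->
  M E k `<=` ideal_gen E (range g) -> M F k `<=` ideal_gen F (range g).
Proof.
move=> Fg Mk; have tF := frac_taylor; have tE := smooth_taylor.
have sF := frac_germs_subring R.
have [_ FE _ [Fx Fy] _] := tF.
have idF := germ_gen_ideal tF Fg.
apply/(exp_subP tF k idF).
have step (a : 'I_k.+1) : exists q : germ_ring R * ('I_k.+1 -> germ_ring R),
    [/\ ideal_gen F (range g) q.1, forall b, F (q.2 b) /\ ev (q.2 b) = 0
      & mono a = q.1 + \sum_b q.2 b * mono b].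
  have Fa : F (mono a) by exact: subring_monomial.
  (* The order k + 1 is one above the degree of the monomial: each error term can then give up a
     factor x or lambda to its coefficient, which thus vanishes at the origin. *)
  have [q gq /(taylor_expP tF)[s [Fs sE]]] :=
    gen_approx tF Fg k.+1 Fa (Mk _ (exp_monomial tE a)).
  (* A degree k + 1 monomial divisible by [xg] is charged to its quotient by [xg]; the remaining
     [yg ^+ k.+1] is charged to [yg ^+ k], of index [ord0]. *)
  exists (q, fun b => (b == ord0)%:R * yg * s ord0 + xg * s (lift ord0 b)).
  split=> //= [b|].
    split; last by rewrite rmorphD !rmorphM /= ev_x ev_lambda mulr0 !mul0r addr0.
    apply: subringD => //; last exact: subringM.
    apply: subringM => //; apply: subringM => //.
    by case: eqP => _; [exact: subring1|exact: subring0].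
  rewrite -[LHS](subrK q) sE addrC; congr (_ + _).
  rewrite big_ord_recl; under [RHS]eq_bigr do rewrite mulrDl.
  rewrite big_split /=; congr (_ + _); last first.
    by apply: eq_bigr => b _; rewrite -monomialMx; ring.
  rewrite (bigD1 ord0)//= big1 ?addr0 => [|b /negPf ->]; last by rewrite !mul0r.
  have -> : mono (ord0 : 'I_k.+2) = yg * mono (ord0 : 'I_k.+1).
    by rewrite monomialMy; congr monomial; exact: val_inj.
  by ring.
have /choice[q Hq] := step.
pose C : 'M[germ_ring R]_k.+1 := \matrix_(a, b) (q a).2 b.
have FC a b : F (C a b) by rewrite mxE; have [_ /(_ b) []] := Hq a.
have FI a b : F ((1%:M - C) a b).
  rewrite !mxE; apply: subringB => //; last by have := FC a b; rewrite mxE.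
  by case: eqP => _; [exact: subring1|exact: subring0].
(* At the origin [1 - C] is the identity matrix, so its determinant is a unit among fractional
   germs. *)
have evC : ev (\det (1%:M - C)) = 1.
  have -> : ev (\det (1%:M - C)) = \det (map_mx (@ev R) (1%:M - C)).
    by rewrite det_map_mx.
  rewrite map_mxB map_mx1 (_ : map_mx _ C = 0) ?subr0 ?det1//.
  by apply/matrixP => a b; rewrite !mxE; have [_ /(_ b) []] := Hq a.
have [||u Fu uE] := @frac_germ_inv (\det (1%:M - C)).
- exact: subring_det.
- by rewrite evC oner_neq0.
apply: (nakayama sF (C := C) (q := fun a => (q a).1) idF FC _ _ Fu uE).
- by move=> a; have [] := Hq a.
- move=> a; have [_ _ {1}->] := Hq a; congr (_ + _).
  by apply: eq_bigr => b _; rewrite mxE.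
Qed.

End TaylorSubrings.

Theorem theorem4p1 (R : realType) :
  let E : set (germ_ring R) := smooth_germs R in
  let F : set (germ_ring R) := frac_germs R in
  let P : set (germ_ring R) := poly_germs R in
  let M (S : set (germ_ring R)) (k : nat) := ideal_exp S (max_ideal S) k in
  let Mlambda (S : set (germ_ring R)) (i j : nat) :=
    ideal_mul S (M S i) (ideal_gen S [set lambda_germ R ^+ j]) in
  [/\ (* (1) *)
      forall (n : nat) (g : 'I_n -> germ_ring R), (forall l, F (g l)) ->
        (finite_codim E (ideal_gen E (range g)) <->
         finite_codim F (ideal_gen F (range g))) /\
        (finite_codim F (ideal_gen F (range g)) ->
         forall i j : nat,
           Mlambda E i j `<=` ideal_gen E (range g) <->
           Mlambda F i j `<=` ideal_gen F (range g)),
      (* (2) *)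
      forall (n : nat) (g : 'I_n -> germ_ring R) (k : nat),
        (forall l, P (g l)) ->
        M P k `<=` ideal_gen P (range g) ->
        forall i j : nat,
          Mlambda P i j `<=` ideal_gen P (range g) <->
          Mlambda E i j `<=` ideal_gen E (range g),
      (* (3) *)
      (forall (n : nat) (g : 'I_n -> germ_ring R) (I : set (germ_ring R)),
         (forall l, F (g l)) ->
         finite_codim F (ideal_gen F (range g)) ->
         is_ideal E I ->
         (I = ideal_gen E (range g) <-> I `&` F = ideal_gen F (range g))) /\
      (forall I J : set (germ_ring R),
         is_ideal E I -> is_ideal E J -> finite_codim E I ->
         I `&` F = J `&` F -> I = J)
    & (* (4) *)
      forall (I : set (germ_ring R)) (k : nat), is_ideal E I ->
        (M E k `<=` I <-> M F k `<=` I `&` F) /\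
        (M F k `<=` I `&` F <-> M P k `<=` I `&` P)].
Proof.
move=> E F P M Mlambda.
have tE := smooth_taylor R; have tF := frac_taylor R; have tP := poly_taylor R.
have FE := @frac_germs_smooth R.
have PE : P `<=` E by move=> h /poly_germs_frac /FE.
(* Stated for a general [S] so as to serve (1) with [F] and (2) with [P]. *)
have lambda_iff (S : set (germ_ring R)) n (g : 'I_n -> germ_ring R) k :
    taylor_subring S -> S `<=` E -> (forall l, S (g l)) ->
    M S k `<=` ideal_gen S (range g) -> forall i j,
    Mlambda E i j `<=` ideal_gen E (range g) <->
    Mlambda S i j `<=` ideal_gen S (range g).
  move=> tS SE Sg Mk i j.
  have Eg l : E (g l) by exact: SE.
  have [sS _ _ [Sx Sy] _] := tS.
  rewrite (mul_lambda_subP tE i j (germ_gen_ideal tE Eg)).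
  rewrite (mul_lambda_subP tS i j (germ_gen_ideal tS Sg)).
  split=> H a; last exact: (gen_smooth tS Sg (H a)).
  apply: (gen_descent tS Sg Mk) => //.
  by apply: subringM => //; [exact: subring_monomial|exact: subringX].
have exp_iff I k : is_ideal E I ->
    (M E k `<=` I <-> M F k `<=` I `&` F) /\
    (M F k `<=` I `&` F <-> M P k `<=` I `&` P).
  move=> idI; rewrite (exp_subP tE k idI) (exp_sub_smoothP tF k idI).
  by rewrite (exp_sub_smoothP tP k idI).
have determined I J k : is_ideal E I -> is_ideal E J -> M E k `<=` I ->
    I `&` F = J `&` F -> I = J.
  move=> idI idJ MI IJ.
  (* The inclusion passes to [J] through the common fractional part, after which the two ideals play
     symmetric roles. *)
  have MJ : M E k `<=` J.
    by apply/(exp_iff J k idJ).1; rewrite -IJ; apply/(exp_iff I k idI).1.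
  have incl I1 I2 : is_ideal E I1 -> is_ideal E I2 -> M E k `<=` I1 -> M E k `<=` I2 ->
      I1 `&` F = I2 `&` F -> I1 `<=` I2.
    move=> id1 [_ _ D2 _] M1 M2 E12 h I1h; have [sub1 _ D1 _] := id1.
    (* A fractional [p] differs from [h] by an element of both ideals, so [p] is in [I1], hence in
       [I2] through the common fractional part, and [h] follows. *)
    have [p Fp hp] := smooth_approx tF k (sub1 _ I1h).
    rewrite -[h](subrK p); apply: D2; first exact: M2.
    suff : (I2 `&` F) p by case.
    rewrite -E12; split=> //; rewrite -[p](subKr h); apply: D1 => //.
    exact: (idealN (smooth_germs_subring R) id1 (M1 _ hp)).
  by apply/seteqP; split; apply: incl.
split.
- move=> n g Fg; have Eg l : E (g l) by exact: FE (Fg l).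
  split; first split.
  + by move=> [k Mk]; exists k; exact: exp_sub_gen_frac.
  + move=> [k Mk]; exists k.
    apply/(exp_subP tE k (germ_gen_ideal tE Eg)) => a.
    by apply: (gen_smooth tF Fg); apply: Mk; exact: exp_monomial.
  + by move=> [k Mk]; exact: (lambda_iff F n g k).
- move=> n g k Pg Mk i j; split; move/(lambda_iff P n g k tP PE Pg Mk i j); exact.
- split=> [n g I Fg [k Mk] idI|I J idI idJ [k Mk]]; last exact: determined Mk.
  have Eg l : E (g l) by exact: FE (Fg l).
  have idg := germ_gen_ideal tE Eg.
  have gF : ideal_gen E (range g) `&` F = ideal_gen F (range g).
    apply/seteqP; split=> [h [gh Fh]|h gh]; first exact: (gen_descent tF Fg Mk Fh gh).
    split; first exact: (gen_smooth tF Fg).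
    by have [sub _ _ _] := germ_gen_ideal tF Fg; exact: sub.
  (* The contraction [gF] settles one direction; for the other it shows that the generated smooth
     ideal contains [M E k] and has the same fractional part as [I]. *)
  split=> [->//|IF]; apply/esym/(determined _ _ k) => //; last by rewrite gF.
  by apply/(exp_iff _ k idg).1; rewrite gF.
- exact: exp_iff.
Qed.
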